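(* Let $m\ge 1$ and let $a_1,\ldots,a_n$ ($n\ge 1$) be positive integers. Then \[ [\![a_1,\ldots,a_n]\!]_m=\#\Omega_m[a_1,\ldots,a_n]=\#\mathcal{L}^*_m[a_1,\ldots,a_n]. \]
   Context: Snake graphs. A tile is a planar graph with four vertices and four edges having the shape of a (unit, axis-parallel) square. A snake graph is a connected planar graph consisting of a finite sequence of tiles $G_1,\ldots,G_d$ such that for each $i=1,\ldots,d-1$ the tiles $G_i$ and $G_{i+1}$ share exactly one edge $e_i$, and $e_i$ is either the north edge of $G_i$ and the south edge of $G_{i+1}$, or the east edge of $G_i$ and the west edge of $G_{i+1}$. A sign function on a snake graph is a map $f$ from its edges to $\{+,-\}$ such that on every tile the north and west edges have the same sign, the south and east edges have the same sign, and the north edge has sign opposite to the south edge. For positive integers $a_1,\ldots,a_n$ let $d=a_1+\cdots+a_n-1$ and let $(s_0,s_1,\ldots,s_d)$ be the sign sequence consisting of $a_1$ signs $-$, followed by $a_2$ signs $+$, followed by $a_3$ signs $-$, and so on alternately. Then $\mathcal{G}[a_1,\ldots,a_n]$ is the unique snake graph with $d$ tiles admitting a sign function $f$ with $f(e_0)=s_0$, where $e_0$ is the south edge of $G_1$, and $f(e_i)=s_i$ for $1\le i\le d-1$. If $d=0$ the graph is a single edge, regarded as having exactly one lattice path. Dimer covers. An $m$-dimer cover of a graph is a multiset of edges such that every vertex is incident to exactly $m$ edges of the multiset (counted with multiplicity). $\Omega_m[a_1,\ldots,a_n]$ is the set of $m$-dimer covers of $\mathcal{G}[a_1,\ldots,a_n]$.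 Dual. The dual snake graph $\mathcal{G}^*$ of $\mathcal{G}=\mathcal{G}[a_1,\ldots,a_n]$ is $\mathcal{G}[b_1,\ldots,b_l]$, where $(b_i)$ is obtained from $(a_i)$ by writing each $a_i$ as $1+1+\cdots+1$ ($a_i$ ones) in the list $a_1,\ldots,a_n$, and then replacing each plus sign by a comma and each comma by a plus sign (e.g. $(2,4,1,2)\mapsto(1,2,1,1,3,1)$). Lattice paths. A lattice path in a snake graph is a path along edges, each step directed north or east, from the south-west vertex of the first tile to the north-east vertex of the last tile. An $m$-multipath is a multiset of $m$ lattice paths; its edge multiset is the multiset of all edges of its paths. Two $m$-multipaths are equivalent if they have the same edge multiset, and an $m$-lattice path is an equivalence class of $m$-multipaths. $\mathcal{L}^*_m[a_1,\ldots,a_n]$ is the set of $m$-lattice paths on the dual snake graph $\mathcal{G}^*$ of $\mathcal{G}[a_1,\ldots,a_n]$. Bracket. Let $\mathcal{G}[1^n]$ be the straight snake graph: a horizontal row of $n-1$ unit squares whose vertical edges are $e_1,\ldots,e_n$ from left to right (a single vertical edge if $n=1$). Then \[ [\![a_1,\ldots,a_n]\!]_m=\sum_{p}\prod_{i=1}^n\binom{a_i+p(e_i)-1}{p(e_i)}, \] the sum being over all $m$-dimer covers $p$ of $\mathcal{G}[1^n]$, where $p(e_i)$ is the multiplicity of $e_i$ in $p$. *)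

(* Defs.v *)
From mathcomp Require Import all_boot.

Set Implicit Arguments.
Unset Strict Implicit.
Unset Printing Implicit Defensive.

(** * Edges and tiles of the square lattice *)

Notation vertex := (nat * nat)%type (only parsing).

(* [((x, y), false)] is the horizontal edge from (x, y) to (x+1, y) and
   [((x, y), true)] is the vertical edge from (x, y) to (x, y+1). *)
Notation edge := (nat * nat * bool)%type (only parsing).

Definition src (e : edge) : vertex := e.1.
Definition tgt (e : edge) : vertex :=
  if e.2 then (e.1.1, e.1.2.+1) else (e.1.1.+1, e.1.2).
Definition ends (e : edge) : seq vertex := [:: src e; tgt e].

(* A tile is given by its south-west corner. *)
Notation tile := (nat * nat)%type (only parsing).

Definition origin : tile := (0, 0).
Definition south (t : tile) : edge := (t, false).
Definition west (t : tile) : edge := (t, true).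
Definition north (t : tile) : edge := ((t.1, t.2.+1), false).
Definition east (t : tile) : edge := ((t.1.+1, t.2), true).
Definition tile_edges (t : tile) : seq edge :=
  [:: south t; west t; north t; east t].

(* The graph formed by the edges of the tiles of G.  The edge e0 is always
   chosen on the boundary of the first tile, so that it is redundant except
   when there is no tile, where the graph is the single edge e0. *)
Definition graph_edges (e0 : edge) (G : seq tile) : seq edge :=
  undup (e0 :: flatten [seq tile_edges t | t <- G]).

Definition vertices (E : seq edge) : seq vertex :=
  undup (flatten [seq ends e | e <- E]).

(** * Snake graphs *)

Definition glued (t u : tile) : bool :=
  (north t == south u) || (east t == west u).

(* Snake graphs are taken up to translation: the first tile is at the origin. *)
Definition is_snake (G : seq tile) : bool :=
  (head origin G == origin) && sorted glued G.

Definition snake_edges (G : seq tile) : seq edge :=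
  graph_edges (south origin) G.

Definition shared_edge (t u : tile) : edge :=
  if north t == south u then north t else east t.

(* The edges e_0, e_1, ..., e_(d-1). *)
Definition spine (G : seq tile) : seq edge :=
  if G is t :: G' then south t :: pairmap shared_edge t G' else [::].

(* The sign + is [true].  Only the values of f on the edges of G matter. *)
Definition sign_function (G : seq tile) (f : edge -> bool) : bool :=
  all (fun t => [&& f (north t) == f (west t), f (south t) == f (east t)
                  & f (north t) != f (south t)]) G.

(* With 0-based indices, the i-th block has sign + iff i is odd. *)
Definition signs (a : seq nat) : seq bool :=
  flatten [seq nseq (nth 0 a i) (odd i) | i <- iota 0 (size a)].

Definition num_tiles (a : seq nat) : nat := (sumn a).-1.

Definition is_snake_of (a : seq nat) (G : seq tile) : Prop :=
  [/\ is_snake G, size G = num_tiles a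
    & exists2 f, sign_function G f
               & [seq f e | e <- spine G] = take (num_tiles a) (signs a)].

Fixpoint build (t : tile) (c : bool) (s : seq bool) : seq tile :=
  t :: if s is b :: s' then
         if b == c then build (t.1.+1, t.2) (~~ c) s'
         else build (t.1, t.2.+1) (~~ c) s'
       else [::].

Definition snake_build (a : seq nat) : seq tile :=
  if take (num_tiles a) (signs a) is c :: s then build origin c s else [::].

Lemma size_signs a : size (signs a) = sumn a.
Proof.
rewrite /signs size_flatten /shape -map_comp.
rewrite (eq_map (g := nth 0 a)); last by move=> i /=; rewrite size_nseq.
by rewrite map_nth_iota0 // take_size.
Qed.

Lemma size_take_signs a : size (take (num_tiles a) (signs a)) = num_tiles a.
Proof. by rewrite size_take_min size_signs /num_tiles; apply/minn_idPl/leq_pred. Qed.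

Lemma size_build t c s : size (build t c s) = (size s).+1.
Proof. by elim: s t c => [|b s IH] t c //=; case: ifP => _; rewrite IH. Qed.

Lemma gluedP t u :
  reflect (u = (t.1, t.2.+1) \/ u = (t.1.+1, t.2)) (glued t u).
Proof.
case: t u => x y [x' y']; rewrite /glued /north /south /east /west /=.
apply: (iffP orP) => -[].
- by move/eqP=> [-> ->]; left.
- by move/eqP=> [-> ->]; right.
- by move=> ->; left.
- by move=> ->; right.
Qed.

Lemma shared_north t : shared_edge t (t.1, t.2.+1) = north t.
Proof. by rewrite /shared_edge eqxx. Qed.

Lemma shared_east t : shared_edge t (t.1.+1, t.2) = east t.
Proof.
by rewrite /shared_edge /north /south /= !xpair_eqE (ltn_eqF (ltnSn _)).
Qed.

Lemma snake_build_unique t G f s :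
  path glued t G -> sign_function (t :: G) f ->
  [seq f e | e <- pairmap shared_edge t G] = s ->
  t :: G = build t (f (south t)) s.
Proof.
elim: G t s => [|u G IH] t [|b s] //= /andP[/gluedP tu pG] /andP[ft fG] [fb fs].
have /andP[fu _] := fG; move: (IH u s pG fG fs) => ->.
case/and3P: ft => /eqP nw /eqP se ns; case/and3P: fu => /eqP nw' /eqP se' ns'.
congr (_ :: _); case: tu => du; rewrite du in fb nw' ns' *.
  rewrite shared_north in fb; rewrite -fb (negbTE ns); congr build.
  by rewrite -[south _]/(north t); move: ns; case: (f _); case: (f _).
rewrite shared_east in fb; rewrite -fb -se eqxx; congr build.
move: ns'; rewrite nw' -[west _]/(east t) -se.
by case: (f _); case: (f _).
Qed.

Lemma snake_build_exists (c0 : bool) t c s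
    (f := fun e : edge => odd (e.1.1 + e.1.2) (+) c0 (+) e.2) :
  c = odd (t.1 + t.2) (+) c0 ->
  [/\ path glued t (behead (build t c s)), sign_function (build t c s) f
    & [seq f e | e <- spine (build t c s)] = c :: s].
Proof.
have hd t' c' s' : build t' c' s' = t' :: behead (build t' c' s').
  by case: s'.
have sgn u : [&& f (north u) == f (west u), f (south u) == f (east u)
                  & f (north u) != f (south u)].
  by case: u => u v; rewrite /f /= !addnS /=; case: odd; case: (c0).
have all_sgn G : sign_function G f by apply/allP=> u _; apply: sgn.
elim: s t c => [|b s IH] [x y] c hc; split; try exact: all_sgn; rewrite //=; rewrite /= in hc.
- by rewrite /f /= addbF hc.
- case: (b =P c) => _.
    have [|+ _ _] := IH (x.+1, y) (~~ c); first by rewrite /= hc addNb.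
    by rewrite (hd (x.+1, y)) /= => ->; rewrite andbT; apply/gluedP; right.
  have [|+ _ _] := IH (x, y.+1) (~~ c); first by rewrite /= hc addnS addNb.
  by rewrite (hd (x, y.+1)) /= => ->; rewrite andbT; apply/gluedP; left.
- have fS : f (south (x, y)) = c by rewrite /f /= addbF hc.
  rewrite fS; congr (_ :: _); case: (b =P c) => bc.
    have [|_ _] := IH (x.+1, y) (~~ c); first by rewrite /= hc addNb.
    rewrite (hd (x.+1, y)) /= => -[_ ->]; rewrite (shared_east (x, y)) bc.
    by case/and3P: (sgn (x, y)) => _ /eqP <- _; rewrite fS.
  have [|_ _] := IH (x, y.+1) (~~ c); first by rewrite /= hc addnS addNb.
  rewrite (hd (x, y.+1)) /= => -[_ ->]; rewrite (shared_north (x, y)).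
  case/and3P: (sgn (x, y)) => _ _; rewrite fS.
  by case: (f _); case: b bc; case: (c).
Qed.

Lemma is_snake_ofP a G : is_snake_of a G <-> G = snake_build a.
Proof.
rewrite /is_snake_of /snake_build; have := size_take_signs a.
case: take => [|c s] /= <-; split.
- by case=> _ /size0nil.
- by move->; split=> //; exists xpredT.
- case: G => [[] //|t G [/andP[/eqP/= -> pG] _ [f fG]]] /= -[<- fs].
  exact: snake_build_unique.
move=> ->; have [//|p sf fs] := @snake_build_exists c origin c s.
split; last by exists (fun e => odd (e.1.1 + e.1.2) (+) c (+) e.2).
- by move: p; rewrite /is_snake; case: (s).
- exact: size_build.
Qed.

Lemma snake_graph_unique a G G' :
  is_snake_of a G -> is_snake_of a G' -> G = G'.
Proof. by move=> /is_snake_ofP -> /is_snake_ofP ->. Qed.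

Lemma snake_graph_sig a : {G | is_snake_of a G}.
Proof. by exists (snake_build a); apply/is_snake_ofP. Qed.

Definition snake_graph (a : seq nat) : seq tile := sval (snake_graph_sig a).

Lemma snake_graphE a : snake_graph a = snake_build a.
Proof. by apply/is_snake_ofP; apply: svalP. Qed.

(** * Dimer covers *)

Definition is_dimer_cover (m : nat) (E : seq edge) (p : seq_sub E -> nat) : bool :=
  all (fun v => \sum_(e : seq_sub E | v \in ends (val e)) p e == m) (vertices E).

Lemma dimer_cover_le m E (p : seq_sub E -> nat) :
  is_dimer_cover m p -> forall e, p e <= m.
Proof.
move=> /allP cov e; have ve : src (val e) \in ends (val e) by rewrite inE eqxx.
have /cov/eqP <- : src (val e) \in vertices E.
  rewrite mem_undup; apply/flatten_mapP; exists (val e) => //; exact: valP.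
by rewrite (bigD1 e) //= leq_addr.
Qed.

(* A multiset of edges is its multiplicity function; multiplicities in an
   m-dimer cover are at most m by [dimer_cover_le]. *)
Definition dimer_covers (m : nat) (E : seq edge) :
    {set {ffun seq_sub E -> 'I_m.+1}} :=
  [set p : {ffun seq_sub E -> 'I_m.+1} |
     is_dimer_cover m (fun e => p e : nat)].

Definition multiplicity (m : nat) (E : seq edge)
    (p : {ffun seq_sub E -> 'I_m.+1}) (e : edge) : nat :=
  if insub e is Some e' then p e' else 0.

Definition Omega (m : nat) (a : seq nat) :=
  dimer_covers m (snake_edges (snake_graph a)).

(** * Dual snake graph *)

(* The separators in the expansion of a_1, ..., a_n as ones: [true] is a comma
   and [false] is a plus sign. *)
Definition separators (a : seq nat) : seq bool :=
  behead (flatten [seq true :: nseq k.-1 false | k <- a]).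

Definition of_separators (s : seq bool) : seq nat :=
  foldr (fun (comma : bool) b =>
           if comma then 1 :: b else (head 0 b).+1 :: behead b) [:: 1] s.

Definition dual (a : seq nat) : seq nat :=
  of_separators [seq ~~ b | b <- separators a].

Lemma separatorsK a :
  a != [::] -> all (leq 1) a -> of_separators (separators a) = a.
Proof.
case: a => // k a _; rewrite /separators /= => /andP[].
elim: a k => [|l a IH] [|k] //= _ pa; first by rewrite cats0; elim: k => //= k ->.
have /andP[l0 al] := pa; have {}IH := IH l l0 al.
elim: k => [|k IHk] /=; first by rewrite IH.
by rewrite IHk.
Qed.

Example dual_example : dual [:: 2; 4; 1; 2] = [:: 1; 2; 1; 1; 3; 1].
Proof. by []. Qed.

(** * Lattice paths *)

(* North-east vertex of the last tile; with no tile, the graph is the edge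
   [south origin], whose unique lattice path is the edge itself. *)
Definition sink (G : seq tile) : vertex :=
  if G is t :: G' then tgt (north (last t G')) else tgt (south origin).

Definition is_lattice_path (G : seq tile) (w : seq edge) : bool :=
  if w is e :: w' then
    [&& src e == head origin G, path (fun e1 e2 => tgt e1 == src e2) e w'
      & tgt (last e w') == sink G]
  else false.

Lemma size_lattice_path G w :
  is_snake G -> is_lattice_path G w -> size w = (size G).+1.
Proof.
have tgtD e : (tgt e).1 + (tgt e).2 = ((src e).1 + (src e).2).+1.
  by case: e => -[x y] [] /=; rewrite ?addnS.
have glue t G' : path glued t G' ->
    (last t G').1 + (last t G').2 = t.1 + t.2 + size G'.
  elim: G' t => [|u G' IH] t /=; first by rewrite addn0.
  by case/andP=> /gluedP tu /IH ->; case: tu => -> /=; rewrite !addnS.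
move=> /andP[/eqP hG sG]; case: w => //= e w /and3P[/eqP se pw /eqP te].
have {se pw te} : (sink G).1 + (sink G).2 = (size w).+1.
  rewrite -te; suff -> : (tgt (last e w)).1 + (tgt (last e w)).2
      = (src e).1 + (src e).2 + (size w).+1 by rewrite se hG.
  elim: w e {se te} pw => [|e' w IH] e /=; first by rewrite tgtD addn1.
  by case/andP=> /eqP ee' /IH ->; rewrite -ee' tgtD !addnS.
case: G hG sG => [|t G] /= => [_ _ <- //|-> pG].
by rewrite addSn addnS (glue _ _ pG) => <-.
Qed.

(* The length is no restriction, by [size_lattice_path]. *)
Notation lattice_path G :=
  {w : (size G).+1.-tuple (seq_sub (snake_edges G)) |
     is_lattice_path G [seq val e | e <- w]}.

Definition multipaths (m : nat) (G : seq tile) :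
    {set {ffun lattice_path G -> 'I_m.+1}} :=
  [set P : {ffun lattice_path G -> 'I_m.+1} | \sum_w P w == m].

Definition edge_multiplicity (m : nat) (G : seq tile)
    (P : {ffun lattice_path G -> 'I_m.+1}) (e : seq_sub (snake_edges G)) : nat :=
  \sum_w P w * count_mem e (val w).

Definition multipath_equiv (m : nat) (G : seq tile) :
    rel {ffun lattice_path G -> 'I_m.+1} :=
  fun P Q => [forall e, edge_multiplicity P e == edge_multiplicity Q e].

Definition lattice_paths (m : nat) (G : seq tile) :=
  equivalence_partition (@multipath_equiv m G) (multipaths m G).

Definition Lstar (m : nat) (a : seq nat) :=
  lattice_paths m (snake_graph (dual a)).

(** * Bracket *)

(* The horizontal row of n - 1 squares, with vertical edges [west (i, 0)] for
   i < n; for n = 1 it is the single vertical edge [west origin]. *)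
Definition row_edges (n : nat) : seq edge :=
  graph_edges (west origin) [seq (i, 0) | i <- iota 0 n.-1].

Definition bracket (m : nat) (a : seq nat) : nat :=
  \sum_(p in dimer_covers m (row_edges (size a)))
    \prod_(i < size a)
      let k := multiplicity p (west (val i, 0)) in 'C(nth 0 a i + k - 1, k).

(* Main.v *)
Require Import Defs.
From mathcomp Require Import all_boot.
From mathcomp Require Import zify.

Set Implicit Arguments.
Unset Strict Implicit.
Unset Printing Implicit Defensive.

(** All three numbers count the same words of edge multiplicities.

    Build a snake graph tile by tile.  A tile is entered through an edge (its
    south or west edge) and left through its north or east edge, and it adds
    three edges to the graph: the two edges other than the entry and the exit,
    and the exit itself.  Suppose that, once everything up to the entry edge is
    chosen, both ends of the entry edge still need k incident edges.  The
    vertices of the tile that lie off the exit edge then force the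
    multiplicities of the first two new edges.  The multiplicity of the exit is
    the only choice, and it is recorded by the number k' that the ends of the
    exit still need.  If the tile is crossed straight (entry and exit opposite)
    the new multiplicities are k, k, m - k - k'; if the tile is a turn (entry
    and exit adjacent) they are k, m - k, k - k'.  At the far end nothing may be
    missing, so the last of these numbers is 0.  This is [dimer_step], and
    [labelings] lists the resulting words.

    An m-lattice path is an integral flow of value m from the south-west to
    the north-east vertex: a sum of m lattice paths is a flow, and a flow
    decomposes into paths because steps go north or east
    ([flow_decomposition]).  Flows are peeled in the same way, where k is now
    the amount that reaches the rest of the graph at the source of the entry
    edge, and m - k the amount that reaches it at the target.  The same two
    rules appear, with straight tiles and turns interchanged ([flow_step]).

    The sign sequence changes exactly at the straight tiles, so the i-th tile is
    straight iff the i-th separator in the expansion of a into ones is a comma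
    ([snake_graph_separators]); for the last tile this is a convention on which
    of its two free edges is called the exit.  Passing to the dual exchanges
    commas and plus signs, hence straight tiles and turns.  Therefore the flows
    on the dual and the dimer covers of the graph have the same words.

    For the bracket, the row of squares is a snake all of whose tiles are
    straight.  In the snake graph of a, the block of a_i replaces one straight
    tile by a straight tile followed by a_i - 1 turns.  Along turns the states
    form a weakly decreasing chain, and the number of such chains between given
    ends is the binomial coefficient of the bracket, by iterated hockey-stick
    summation ([sum_weight_labelings]). *)

(** * Words of multiplicities along a snake *)

(** The three multiplicities added by a tile that takes the state [k] to [k'];
    for dimer covers [g] means that the tile is crossed straight, for flows
    that it is a turn. *)
Definition step_labels (m : nat) (g : bool) (k k' : nat) : seq nat :=
  [:: k; if g then k else m - k; if g then m - k - k' else k - k'].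

(** The bound on [k'] makes both subtractions in [step_labels] exact, as long
    as [k <= m], which the bound preserves. *)
Fixpoint labelings (m : nat) (gs : seq bool) (k : nat) : seq (seq nat) :=
  if gs is g :: gs' then
    [seq step_labels m g k k' ++ l
       | k' <- iota 0 (if g then m - k else k).+1, l <- labelings m gs' k']
  else if k == 0 then [:: [::]] else [::].

Lemma labelings_consP m g gs k l :
  reflect (exists k' l', [/\ k' <= (if g then m - k else k),
                            l' \in labelings m gs k'
                          & l = step_labels m g k k' ++ l'])
          (l \in labelings m (g :: gs) k).
Proof.
apply: (iffP allpairsPdep) => -[k' [l' [Hk' Hl' ->]]];
  exists k', l'; split=> //.
  by move: Hk'; rewrite mem_iota add0n ltnS.
by rewrite mem_iota add0n ltnS.
Qed.

(** The state [k'] can be read off from the third label of a step. *)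
Lemma uniq_labelings m gs k : uniq (labelings m gs k).
Proof.
elim: gs k => [|g gs IH] k; first by rewrite /=; case: ifP.
apply: allpairs_uniq_dep; [exact: iota_uniq | by move=> k' _; apply: IH |].
move=> _ _ /allpairsPdep[x [y [xP yP ->]]] /allpairsPdep[x' [y' [x'P y'P ->]]].
move: xP x'P; rewrite !mem_iota !add0n !ltnS /step_labels /= => hx hx'.
case=> ex ey; have exx : x = x' by case: g hx hx' ex; lia.
by rewrite exx in yP ey *; rewrite ey.
Qed.

Lemma sum_labelings_cons m g gs k (F : seq nat -> nat) :
  \sum_(l <- labelings m (g :: gs) k) F l
    = \sum_(0 <= k' < (if g then m - k else k).+1)
        \sum_(l <- labelings m gs k') F (step_labels m g k k' ++ l).
Proof. by rewrite /index_iota subn0 big_allpairs_dep. Qed.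

Lemma size_labelings_cons m g gs k :
  size (labelings m (g :: gs) k)
    = \sum_(0 <= k' < (if g then m - k else k).+1) size (labelings m gs k').
Proof.
rewrite -sum1_size sum_labelings_cons.
by apply: eq_bigr => k' _; rewrite sum1_size.
Qed.

Lemma size_labeling m gs k l : l \in labelings m gs k -> size l = 3 * size gs.
Proof.
elim: gs k l => [|g gs IH] k l.
  by rewrite /=; case: ifP; rewrite ?inE // => _ /eqP->.
case/labelings_consP=> k' [l' [_ /IH Hl' ->]].
by rewrite size_cat Hl' /= mulnS.
Qed.

Lemma labeling_le m gs k l :
  k <= m -> l \in labelings m gs k -> all (leq^~ m) l.
Proof.
elim: gs k l => [|g gs IH] k l km.
  by rewrite /=; case: ifP; rewrite ?inE // => _ /eqP->.
case/labelings_consP=> k' [l' [Hk' Hl' ->]]; rewrite all_cat.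
have k'm : k' <= m by case: g Hk'; lia.
by rewrite (IH _ l' k'm Hl') andbT /= km; case: g Hk' => /=; lia.
Qed.

(** * From words on a row to words on a snake *)

(** Hockey-stick summation, weighted by [x]: adding one more link to a weakly
    decreasing chain from [k] to [j] raises the upper index by one. *)
Lemma sum_binom_conv c k (x : nat -> nat) :
  \sum_(0 <= k' < k.+1) \sum_(0 <= j < k'.+1) 'C(c + (k' - j), k' - j) * x j
    = \sum_(0 <= j < k.+1) 'C(c.+1 + (k - j), k - j) * x j.
Proof.
elim: k => [|k IH]; first by rewrite !big_nat1 !bin0.
rewrite big_nat_recr //= IH [in X in _ + X]big_nat_recr //.
rewrite [RHS]big_nat_recr //=.
rewrite !subnn !bin0 addnA; congr (_ + _).
rewrite -big_split /=; apply: eq_big_nat => j /andP[_]; rewrite ltnS => jk.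
by rewrite subSn // !addSn !addnS [in RHS]binS mulnDl addnC.
Qed.

(** A step with flag [false] only lowers the state, so [c] of them contribute
    the number of weakly decreasing chains from [k] to [j]. *)
Lemma sum_labelings_chain m c gs k :
  \sum_(0 <= k' < k.+1) size (labelings m (nseq c false ++ gs) k')
    = \sum_(0 <= j < k.+1) 'C(c + (k - j), k - j) * size (labelings m gs j).
Proof.
elim: c k => [|c IH] k.
  by apply: eq_big_nat => j _; rewrite binn mul1n.
rewrite -sum_binom_conv; apply: eq_big_nat => k' _.
by rewrite [nseq _ _ ++ _]/= size_labelings_cons IH.
Qed.

(** The product of binomial coefficients in the bracket, evaluated on a word of
    the row: every third label is the multiplicity of a vertical edge. *)
Fixpoint weight (a l : seq nat) : nat :=
  match a, l with
  | x :: a', _ :: _ :: y :: l' => 'C(x + y - 1, y) * weight a' l'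
  | _, _ => 1
  end.

(** The separators of [a] preceded by one comma, so that each entry of [a]
    contributes one complete block. *)
Definition blocks (a : seq nat) : seq bool :=
  flatten [seq true :: nseq k.-1 false | k <- a].

(** The state after a block of [a] is the state after the corresponding tile of
    the row; the binomial coefficient counts the intermediate states. *)
Lemma sum_weight_labelings m a j : all (leq 1) a ->
  \sum_(l <- labelings m (nseq (size a) true) j) weight a l
    = size (labelings m (blocks a) j).
Proof.
elim: a j => [|x a IH] j.
  by rewrite /=; case: ifP => _; rewrite ?big_seq1 ?big_nil.
case/andP=> x1 /IH{}IH; rewrite -[nseq _ _]/(true :: nseq (size a) true).
rewrite -[blocks _]/(true :: (nseq x.-1 false ++ blocks a)).
rewrite sum_labelings_cons size_labelings_cons sum_labelings_chain.
apply: eq_bigr => k' _; rewrite -IH big_distrr /=.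
by apply: eq_bigr => l _; congr ('C(_, _) * _); lia.
Qed.

(** * Snakes encoded by straight tiles and turns *)

(** The neighbour of [t] to the east ([b] is [true]) or to the north.  The edge
    [(step b t, b)] is the one shared with [t]; an edge [(t, v)] through which
    [t] is entered has the same form, which is what makes recursion on the list
    of tiles possible. *)
Definition step (b : bool) (t : tile) : tile :=
  if b then (t.1.+1, t.2) else (t.1, t.2.+1).

(** The snake entered through [(t, v)] whose i-th tile is crossed straight iff
    the i-th entry of [gs] is [true].  The direction of the exit is [g == v].
    The last entry only chooses which of the two free edges of the last tile is
    called its exit. *)
Fixpoint snake (t : tile) (v : bool) (gs : seq bool) : seq tile :=
  if gs is g :: gs' then t :: snake (step (g == v) t) (g == v) gs' else [::].

(** The order is that of the labels in [step_labels]: the edge at the corner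
    [t] has to meet the whole demand of that corner, and the exit comes last. *)
Definition new_edges (t : tile) (v g : bool) : seq edge :=
  [:: (t, ~~ v); (step (g != v) t, g != v); (step (g == v) t, g == v)].

Fixpoint later_edges (t : tile) (v : bool) (gs : seq bool) : seq edge :=
  if gs is g :: gs' then
    new_edges t v g ++ later_edges (step (g == v) t) (g == v) gs'
  else [::].

Fixpoint last_edge (t : tile) (v : bool) (gs : seq bool) : edge :=
  if gs is g :: gs' then last_edge (step (g == v) t) (g == v) gs' else (t, v).

Lemma later_edges_cons t v g gs :
  later_edges t v (g :: gs)
    = new_edges t v g ++ later_edges (step (g == v) t) (g == v) gs.
Proof. by []. Qed.

Lemma later_edges_ge t v gs e :
  e \in later_edges t v gs -> (t.1 <= e.1.1) && (t.2 <= e.1.2).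
Proof.
elim: gs t v => [|g gs IH] [x y] v //.
rewrite later_edges_cons mem_cat => /orP[|/IH]; last first.
  by rewrite /step; case: eqP => _ /=; lia.
rewrite !inE /step {IH}; case: e => [[a b] d] /=.
by case/or3P=> /eqP; do ?case: ifP => _; case=> -> -> _ /=; lia.
Qed.

Lemma uniq_later_edges t v gs : uniq ((t, v) :: later_edges t v gs).
Proof.
elim: gs t v => [|g gs IH] t v //.
rewrite later_edges_cons; set u := step (g == v) t.
move: (IH u (g == v)) => /= /andP[H1 ->]; rewrite andbT.
have H e : ~~ ((u.1 <= e.1.1) && (u.2 <= e.1.2)) ->
    (e \in later_edges u (g == v) gs) = false.
  by apply: contraNF; apply: later_edges_ge.
rewrite !inE (negbTE H1) !H ?andbT // /u.
all: case: (t) v g {H H1 u} => x y [] []; rewrite /step /= ?ltnn ?andbF //.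
all: by rewrite !xpair_eqE /= ?andbF ?andbT; lia.
Qed.

Lemma mem_graph_snake t v gs :
  graph_edges (t, v) (snake t v gs) =i (t, v) :: later_edges t v gs.
Proof.
move=> e; rewrite /graph_edges mem_undup.
elim: gs t v => [|g gs IH] t v //=.
have := IH (step (g == v) t) (g == v); rewrite !inE => H.
rewrite -H {H}.
case: (e \in flatten _) => /=; rewrite ?orbT ?orbF //.
rewrite /south /north /west /east /step.
case: v g => [] [] /=; move: (e == (t, true)) (e == (t, false)).
all: move: (e == (t.1.+1, t.2, true)) (e == (t.1, t.2.+1, false)).
all: by do 4!case.
Qed.

(** * Dimer covers *)

Definition incident (E : seq edge) (w : vertex) : bool :=
  has (fun e => w \in ends e) E.
Definition degree (E : seq edge) (p : edge -> nat) (w : vertex) : nat :=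
  \sum_(e <- E | w \in ends e) p e.

(** Applied to the tile after [t], this says that the corners of [t] off its
    exit edge only see the edges of [t]. *)
Lemma later_edges_far t v gs p w : ~~ ((t.1 <= w.1) && (t.2 <= w.2)) ->
  (degree (later_edges t v gs) p w = 0)
  * (incident (later_edges t v gs) w = false).
Proof.
move=> far.
have H e : e \in later_edges t v gs -> (w \in ends e) = false.
  move=> /later_edges_ge; move: far; case: e w => [[a b] d] [w1 w2].
  rewrite /ends /src /tgt !inE /= !xpair_eqE.
  by case: d => /=; rewrite ?xpair_eqE; lia.
split; last by apply/hasP => -[e /H ->].
by rewrite /degree big_seq_cond big1 // => e /andP[/H ->].
Qed.

(** Only the four corners of a tile with south-west corner [(x, y)] need to be
    told apart. *)
Local Ltac case_corners a b x y :=
  (have [->|?] := eqVneq a x; [|have [->|?] := eqVneq a x.+1]);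
  (have [->|?] := eqVneq b y; [|have [->|?] := eqVneq b y.+1]).

(** One tile of the peeling: [D] and [I] stand for the degree and the incidence
    in the rest of the graph.  The demands at the corners off the exit edge fix
    [x1] and [x2], and the demands at the two ends of the exit edge agree
    because the graph is bipartite; their common value is [k']. *)
Lemma dimer_step (m : nat) (t : tile) (v g : bool) (k x1 x2 x3 : nat)
    (D : vertex -> nat) (I : vertex -> bool) :
  k <= m ->
  (forall w,
     ~~ (((step (g == v) t).1 <= w.1) && ((step (g == v) t).2 <= w.2)) ->
     (D w = 0) * (I w = false)) ->
  (forall w,
     (if w \in ends (t, ~~ v) then x1 else 0) +
     ((if w \in ends (step (g != v) t, g != v) then x2 else 0) +
      ((if w \in ends (step (g == v) t, g == v) then x3 else 0) + D w)) =
     if w \in ends (t, v) then k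
     else if [|| w \in ends (t, ~~ v), w \in ends (step (g != v) t, g != v),
                 w \in ends (step (g == v) t, g == v) | I w] then m else 0)
  <-> (exists k', [/\ k' <= (if g then m - k else k),
          [:: x1; x2; x3] = step_labels m g k k' &
          forall w, D w = if w \in ends (step (g == v) t, g == v) then k'
                          else if I w then m else 0]).
Proof.
have E1 n : (n == n.+1) = false by lia.
have E2 n : (n.+1 == n) = false by lia.
case: t => x y; rewrite /step_labels => km far; split.
- move=> H; exists (if g then m - k - x3 else k - x3).
  have := H (x, y); have := H (x.+1, y).
  have := H (x, y.+1); have := H (x.+1, y.+1).
  have := far (x, y); have := far (x.+1, y); have := far (x, y.+1).
  move: far H; rewrite /ends /src /tgt /step.
  case: v g => [] []; rewrite /= !inE !xpair_eqE !eqxx !E1 !E2 /=;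
    rewrite ?ltnn ?leqnn ?leqnSn ?andbF ?andbT ?orbT ?orbF /= => far H;
    (* exactly two of the three corners are off the exit edge *)
    do 3 (first [case/(_ isT)=> -> _ | move=> _]); move=> h1 h2 h3 h4;
    (split=> [|| [a b]]; [lia | congr [:: _; _; _]; lia |]);
    move: (H (a, b)) (far (a, b)); rewrite !inE !xpair_eqE /=;
    case_corners a b x y;
    rewrite ?E1 ?E2 ?ltnn ?leqnn ?leqnSn ?andbF /= => H1 H2;
    first [lia | case: (H2 isT) H1 => -> -> /=; lia
               | case: (I _) H1 => /=; lia].
- case=> k' [hk' [-> -> ->] HD] [a b]; rewrite HD.
  move: (far (a, b)); rewrite HD.
  move: hk'; rewrite /ends /src /tgt /step.
  case: v g {far HD} => [] []; rewrite !inE !xpair_eqE /= => hk';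
    case_corners a b x y;
    rewrite ?E1 ?E2 ?ltnn ?leqnn ?leqnSn ?andbF /= => H2;
    first [lia | case: (H2 isT) => ? -> /=; lia | case: (I _) => /=; lia].
Qed.

Lemma degree_cons e E p w :
  degree (e :: E) p w = (if w \in ends e then p e else 0) + degree E p w.
Proof. by rewrite /degree big_cons; case: ifP. Qed.

(** The induction step shared by dimer covers and flows: [g] gives the shape of
    the snake, [h] the rule for the labels, and [Q] what remains to be satisfied
    beyond the exit edge. *)
Lemma labelings_stepP m t v g gs h hs k p (Q : nat -> Prop)
    (u := step (g == v) t) (b := g == v) :
  k <= m ->
  (forall k', k' <= m ->
     Q k' <-> [seq p e | e <- later_edges u b gs] \in labelings m hs k') ->
  (exists k', [/\ k' <= (if h then m - k else k),
                [seq p e | e <- new_edges t v g] = step_labels m h k k' & Q k'])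
  <-> [seq p e | e <- later_edges t v (g :: gs)] \in labelings m (h :: hs) k.
Proof.
move=> km HQ.
have k'm k' : k' <= (if h then m - k else k) -> k' <= m by case: (h); lia.
rewrite later_edges_cons map_cat; split.
  case=> k' [Hk' -> /(HQ _ (k'm _ Hk')) Hl].
  by apply/labelings_consP; exists k', [seq p e | e <- later_edges u b gs].
case/labelings_consP=> k' [l [Hk' Hl /eqP]].
rewrite eqseq_cat // => /andP[/eqP Hn /eqP El].
by exists k'; split=> //; apply/(HQ _ (k'm _ Hk')); rewrite El.
Qed.

Lemma dimer_later_edges m t v gs k p : k <= m ->
  (forall w, degree (later_edges t v gs) p w
     = if w \in ends (t, v) then k
       else if incident (later_edges t v gs) w then m else 0)
  <-> [seq p e | e <- later_edges t v gs] \in labelings m gs k.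
Proof.
elim: gs t v k => [|g gs IH] t v k km.
  rewrite /degree /incident /=; split=> [/(_ t)|].
    by rewrite big_nil /ends inE eqxx /= => <-.
  by case: eqP => // -> _ w; rewrite big_nil if_same.
rewrite -(labelings_stepP g km (IH (step (g == v) t) (g == v))).
rewrite -(@dimer_step m t v g k _ _ _ _ _ km
  (@later_edges_far (step (g == v) t) (g == v) gs p)).
by split=> H w; move: (H w); rewrite later_edges_cons !degree_cons.
Qed.

(** The first edge behaves like the exit of a straight tile entered in state 0,
    whose other two edges have multiplicity 0: hence the prefix [:: 0, 0 & _]
    and the extra flag [true]. *)
Lemma dimer_snake_edges m t v gs p (E := (t, v) :: later_edges t v gs) :
  (forall w, degree E p w = if incident E w then m else 0)
  <-> [:: 0, 0 & [seq p e | e <- E]] \in labelings m (true :: gs) 0.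
Proof.
split=> [H | /labelings_consP[k [l [km Hl [Ep El]]]] w].
  have e0m : p (t, v) <= m.
    have := H t; rewrite /E degree_cons /incident /= {1 2}/ends /=.
    by rewrite inE eqxx /=; lia.
  apply/labelings_consP.
  exists (m - p (t, v)), [seq p e | e <- later_edges t v gs].
  split; [by rewrite subn0 leq_subr | | by rewrite /step_labels /= subn0 subKn].
  apply/dimer_later_edges => [|w]; first exact: leq_subr.
  have := H w; rewrite /E degree_cons /incident /=.
  by case: ifP => _ /=; lia.
rewrite !subn0 in km Ep; move: Hl; rewrite -El.
move=> /(dimer_later_edges _ _ _ _ km) H.
by rewrite /E degree_cons H Ep /incident /=; case: ifP => _ /=; lia.
Qed.

(** * Flows *)

Definition outflow (E : seq edge) (p : edge -> nat) (w : vertex) : nat :=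
  \sum_(e <- E | src e == w) p e.
Definition inflow (E : seq edge) (p : edge -> nat) (w : vertex) : nat :=
  \sum_(e <- E | tgt e == w) p e.

(** A flow of value [m] from [s] to [z], without subtraction: the value is
    received at the source and given back at the sink. *)
Definition flow (m : nat) (s z : vertex) (E : seq edge) (p : edge -> nat) :=
  forall w, outflow E p w + (if w == z then m else 0)
          = inflow E p w + (if w == s then m else 0).

Lemma outflow_cons e E p w :
  outflow (e :: E) p w = (if src e == w then p e else 0) + outflow E p w.
Proof. by rewrite /outflow big_cons; case: ifP. Qed.

Lemma inflow_cons e E p w :
  inflow (e :: E) p w = (if tgt e == w then p e else 0) + inflow E p w.
Proof. by rewrite /inflow big_cons; case: ifP. Qed.

Lemma last_edge_ge t v gs :
  (t.1 <= (last_edge t v gs).1.1) && (t.2 <= (last_edge t v gs).1.2).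
Proof.
elim: gs t v => [|g gs IH] t v /=; first by rewrite !leqnn.
by have := IH (step (g == v) t) (g == v); rewrite /step; case: ifP => /= _; lia.
Qed.

Lemma flow_later_far t v gs p w : ~~ ((t.1 <= w.1) && (t.2 <= w.2)) ->
  [/\ outflow (later_edges t v gs) p w = 0, inflow (later_edges t v gs) p w = 0
    & (w == tgt (last_edge t v gs)) = false].
Proof.
move=> far; split.
- rewrite /outflow big_seq_cond big1 // => e /andP[/later_edges_ge + /eqP ew].
  by rewrite -ew in far; rewrite (negbTE far).
- rewrite /inflow big_seq_cond big1 // => e /andP[/later_edges_ge + /eqP ew].
  by rewrite -ew in far; move: far; rewrite /tgt; case: ifP => _ /=; lia.
apply: contraNF far => /eqP->; have := last_edge_ge t v gs.
by rewrite /tgt; case: ifP => _ /=; lia.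
Qed.

Lemma inflow_later_entry t v gs p : inflow (later_edges t v gs) p t = 0.
Proof.
rewrite /inflow big_seq_cond big1 // => e /andP[/later_edges_ge + /eqP et].
move: et; case: e t => [[a b] d] [x y].
by case: d; rewrite /tgt /= => -[<- <-]; lia.
Qed.

Lemma snake_end_neq t v gs : (t == tgt (last_edge t v gs)) = false.
Proof.
apply/eqP; move: (last_edge t v gs) (last_edge_ge t v gs) => [[a b] d].
by case: t => x y; case: d => /= xy; rewrite /tgt /= => -[]; lia.
Qed.

(** One tile of the peeling for flows: [O], [N] and [Z] stand for the outflow,
    the inflow and the position of the sink in the rest of the graph.  Of the
    amount [m] that crosses the tile, [k] enters at the source of the entry edge
    and [m - k] at its target.  A turn makes the source of the exit edge
    the corner that was the target of the entry edge, which is why the label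
    rule is that of [~~ g]. *)
Lemma flow_step (m : nat) (t : tile) (v g : bool) (k x1 x2 x3 : nat)
    (O N : vertex -> nat) (Z : vertex -> bool) :
  k <= m ->
  (forall w,
     ~~ (((step (g == v) t).1 <= w.1) && ((step (g == v) t).2 <= w.2)) ->
     [/\ O w = 0, N w = 0 & Z w = false]) ->
  N (step (g == v) t) = 0 -> Z (step (g == v) t) = false ->
  (forall w,
     (if src (t, ~~ v) == w then x1 else 0) +
     ((if src (step (g != v) t, g != v) == w then x2 else 0) +
      ((if src (step (g == v) t, g == v) == w then x3 else 0) + O w)) +
     (if Z w then m else 0)
   = (if tgt (t, ~~ v) == w then x1 else 0) +
     ((if tgt (step (g != v) t, g != v) == w then x2 else 0) +
      ((if tgt (step (g == v) t, g == v) == w then x3 else 0) + N w)) +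
     (if w == src (t, v) then k else 0) +
     (if w == tgt (t, v) then m - k else 0))
  <-> (exists k', [/\ k' <= (if ~~ g then m - k else k),
          [:: x1; x2; x3] = step_labels m (~~ g) k k' &
          forall w, O w + (if Z w then m else 0)
             = N w + (if w == src (step (g == v) t, g == v) then k' else 0)
               + (if w == tgt (step (g == v) t, g == v) then m - k' else 0)]).
Proof.
have E1 n : (n == n.+1) = false by lia.
have E2 n : (n.+1 == n) = false by lia.
case: t => x y; rewrite /step_labels => km far N0 Z0; split.
- move=> H; exists (if ~~ g then m - k - x3 else k - x3).
  have := H (x, y); have := H (x.+1, y).
  have := H (x, y.+1); have := H (x.+1, y.+1).
  have := far (x, y); have := far (x.+1, y); have := far (x, y.+1).
  move: far N0 Z0 H; rewrite /src /tgt /step.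
  case: v g => [] []; rewrite /= !xpair_eqE !eqxx !E1 !E2 /=;
    rewrite ?ltnn ?leqnn ?leqnSn ?andbF ?andbT ?orbT ?orbF /=;
    move=> far N0 Z0 H; rewrite ?N0 ?Z0;
    (* exactly two of the three corners are off the exit edge *)
    do 3 (first [case/(_ isT)=> -> -> -> | move=> _]); move=> h1 h2 h3 h4;
    (split=> [|| [a b]]; [lia | congr [:: _; _; _]; lia |]);
    move: (H (a, b)) (far (a, b)); rewrite !xpair_eqE /=;
    case_corners a b x y;
    rewrite ?E1 ?E2 ?ltnn ?leqnn ?leqnSn ?andbF /= => H1 H2;
    first [lia | case: (H2 isT) H1 => -> -> -> /=; lia].
- case=> k' [hk' [-> -> ->] HD] [a b].
  move: (far (a, b)) (HD (a, b)).
  move: N0 Z0 hk'; rewrite /src /tgt /step.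
  case: v g {far HD} => [] []; rewrite !xpair_eqE /= => N0 Z0 hk';
    case_corners a b x y;
    rewrite ?E1 ?E2 ?ltnn ?leqnn ?leqnSn ?andbF /= => H2 H1;
    first [lia | case: (H2 isT) H1 => -> -> -> /=; lia].
Qed.

Lemma flow_later_edges m t v gs k p : k <= m ->
  (forall w, outflow (later_edges t v gs) p w
       + (if w == tgt (last_edge t v gs) then m else 0)
     = inflow (later_edges t v gs) p w + (if w == src (t, v) then k else 0)
       + (if w == tgt (t, v) then m - k else 0))
  <-> [seq p e | e <- later_edges t v gs] \in labelings m (map negb gs) k.
Proof.
elim: gs t v k => [|g gs IH] t v k km.
  rewrite /outflow /inflow /=; split=> [/(_ t)|].
    rewrite !big_nil eqxx; have -> : (t == tgt (t, v)) = false.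
      by case: t => x y; case: v; rewrite /tgt xpair_eqE /=; lia.
    by rewrite !add0n addn0 => <-.
  by case: eqP => // -> _ w; rewrite !big_nil subn0 if_same.
rewrite -(labelings_stepP (~~ g) km (IH (step (g == v) t) (g == v))).
rewrite -(@flow_step m t v g k _ _ _ _ _ (fun w => w == _) km
  (@flow_later_far (step (g == v) t) (g == v) gs p))
  ?inflow_later_entry ?snake_end_neq //.
split=> H w; move: (H w);
  by rewrite later_edges_cons !outflow_cons !inflow_cons.
Qed.

(** The first edge again acts as the exit of a tile entered in state 0; with
    the rule [true] that tile sends [m] units to the source of the edge. *)
Lemma flow_snake_edges m t v gs p (E := (t, v) :: later_edges t v gs) :
  flow m t (tgt (last_edge t v gs)) E p
  <-> [:: 0, 0 & [seq p e | e <- E]] \in labelings m (true :: map negb gs) 0.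
Proof.
have tv : (tgt (t, v) == t) = false.
  by case: t {E} => x y; case: v; rewrite /tgt xpair_eqE /=; lia.
split=> [H | /labelings_consP[k [l [km Hl [Ep El]]]] w].
  have e0m : p (t, v) <= m.
    have := H t; rewrite /E outflow_cons inflow_cons.
    by rewrite inflow_later_entry snake_end_neq tv !eqxx /=; lia.
  apply/labelings_consP.
  exists (m - p (t, v)), [seq p e | e <- later_edges t v gs].
  split; [by rewrite subn0 leq_subr | | by rewrite /step_labels /= subn0 subKn].
  apply/flow_later_edges => [|w]; first exact: leq_subr.
  have := H w; rewrite /E outflow_cons inflow_cons subKn //= ![w == _]eq_sym.
  by case: (t =P w) => [<-|_]; rewrite ?tv; case: ifP => _ /=; lia.
rewrite !subn0 in km Ep; move: Hl; rewrite -El.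
move=> /(flow_later_edges _ _ _ _ km) H.
have := H w; rewrite /E outflow_cons inflow_cons Ep /= ![w == _]eq_sym.
by case: (t =P w) => [<-|_]; rewrite ?tv; case: ifP => _ /=; lia.
Qed.

(** * Decomposition of flows into trails *)

Fixpoint trail (v z : vertex) (w : seq edge) : bool :=
  if w is e :: w' then (src e == v) && trail (tgt e) z w' else v == z.

(** Every edge raises the level by one, which rules out cycles. *)
Definition level (v : vertex) : nat := v.1 + v.2.

Lemma level_tgt e : level (tgt e) = (level (src e)).+1.
Proof. by case: e => [[x y] []]; rewrite /level /tgt /src /= ?addnS. Qed.

Lemma trail_level v z w e : trail v z w -> e \in w -> level v <= level (src e).
Proof.
elim: w v => //= e' w IH v /andP[/eqP <- /IH{}IH].
rewrite inE => /predU1P[-> // |/IH].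
by rewrite level_tgt; apply: leq_trans.
Qed.

Lemma uniq_trail v z w : trail v z w -> uniq w.
Proof.
elim: w v => //= e w IH v /andP[_ tw]; rewrite (IH _ tw) andbT.
by apply/negP => /(trail_level tw); rewrite level_tgt ltnn.
Qed.

Lemma sum_count_mem (T : eqType) (r s : seq T) (P : pred T) (F : T -> nat) :
  uniq r -> {subset s <= r} ->
  \sum_(x <- r | P x) count_mem x s * F x = \sum_(x <- s | P x) F x.
Proof.
move=> ur; elim: s => [|y s IH] sr /=; first by rewrite big_nil big1.
under eq_bigr do rewrite mulnDl.
rewrite big_split /= IH => [|x xs]; last by rewrite sr // inE xs orbT.
rewrite big_cons big_mkcond (bigD1_seq y) ?sr ?mem_head //= eqxx mul1n.
rewrite big1 => [|x /negPf]; last by rewrite eq_sym => ->; case: (P _).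
by case: (P y); rewrite ?addn0.
Qed.

Lemma flow_trail E s z w : uniq E -> {subset w <= E} -> trail s z w ->
  flow 1 s z E (fun e => count_mem e w).
Proof.
move=> uE wE tw x; rewrite /outflow /inflow.
have cE (P : pred edge) : \sum_(e <- E | P e) count_mem e w = count P w.
  rewrite -sum1_count -(sum_count_mem _ _ uE wE).
  by under [RHS]eq_bigr do rewrite muln1.
rewrite !cE {cE}.
elim: w s tw {wE} => [|e w IH] s /=; first by move/eqP->.
case/andP=> /eqP <- /IH; rewrite /= [src e == x]eq_sym [tgt e == x]eq_sym.
by do 3 case: eqP; lia.
Qed.

Lemma flow_sum (I : finType) (n : I -> nat) (q : I -> edge -> nat) s z E :
  (forall i, flow 1 s z E (q i)) ->
  flow (\sum_i n i) s z E (fun e => \sum_i n i * q i e).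
Proof.
move=> fq x; rewrite /outflow /inflow.
rewrite exchange_big [in RHS]exchange_big /=.
have ifE (b : bool) :
    (if b then \sum_i n i else 0) = \sum_i n i * (if b then 1 else 0).
  by rewrite -big_distrl /=; case: b; rewrite ?muln1 ?muln0.
rewrite !ifE -!big_split /=; apply: eq_bigr => i _.
by have := fq i x; rewrite -!big_distrr -!mulnDr => <-.
Qed.

Lemma trail_level_le v z w : trail v z w -> level v <= level z.
Proof.
elim: w v => [v /eqP-> //|e w IH v /= /andP[/eqP <- /IH]].
by rewrite level_tgt; apply: ltnW.
Qed.

(** Away from the sink [z], a vertex that receives a positive amount passes some
    of it on, and the levels of the edges in [E] are bounded, so the walk can
    only stop at [z]. *)
Lemma flow_positive_trail m s z E p v : flow m s z E p ->
  (v == z) || (0 < outflow E p v) ->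
  exists2 w, trail v z w & forall e, e \in w -> (e \in E) && (0 < p e).
Proof.
move=> fp; pose D := \max_(e <- E) level (tgt e).
have [n] := ubnP (D.+1 - level v); elim: n v => // n IH v Hn.
case: (v =P z) => [-> _|/eqP vz /=]; first by exists [::] => //=.
rewrite lt0n sum_nat_seq_neq0 => /hasP[e eE /andP[/eqP ev pe]].
have lt_D : level (tgt e) <= D by apply: leq_bigmax_seq.
have lt_e : level (tgt e) = (level v).+1 by rewrite level_tgt ev.
have [||w tw wp] := IH (tgt e); first by lia.
  apply/orP; case: (tgt e =P z) => [|/eqP/negPf tz]; [by left | right].
  have := fp (tgt e); rewrite tz addn0 => ->; rewrite ltn_addr // lt0n.
  by rewrite sum_nat_seq_neq0; apply/hasP; exists e; rewrite ?eqxx.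
exists (e :: w) => [|e']; first by rewrite /= ev eqxx.
by rewrite inE => /predU1P[->|/wp //]; rewrite eE lt0n.
Qed.

(** A flow of value 0 has no distinguished sink, so any vertex can be taken as
    sink in the previous lemma.  If [e] carried something, there would be a
    trail from [tgt e] to [src e], although levels increase along trails. *)
Lemma flow0 s z E p e : flow 0 s z E p -> e \in E -> p e = 0.
Proof.
move=> fp eE; apply/eqP; case: eqP => // /eqP pe.
have [||w /trail_level_le] := @flow_positive_trail 0 s (src e) E p (tgt e).
- by move=> w; have := fp w; rewrite !if_same.
- apply/orP; right; have := fp (tgt e); rewrite !if_same !addn0 => ->.
  by rewrite lt0n sum_nat_seq_neq0; apply/hasP; exists e; rewrite ?eqxx.
by rewrite level_tgt ltnn.
Qed.

(** Take away one trail after another.  A trail uses every edge at most once,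
    so subtracting it from a flow that is positive along it is exact. *)
Lemma flow_decomposition m s z E p : uniq E -> flow m s z E p ->
  exists ws : seq (seq edge),
    [/\ size ws = m, forall w, w \in ws -> trail s z w /\ {subset w <= E}
      & forall e, e \in E -> p e = \sum_(w <- ws) count_mem e w].
Proof.
move=> uE; elim: m p => [|m IH] p fp.
  by exists [::]; split=> // e eE; rewrite big_nil (flow0 fp eE).
have [|w tw wp] := flow_positive_trail fp (v := s).
  apply/orP; case: (s =P z) => [|/eqP/negPf sz]; [by left | right].
  by have := fp s; rewrite sz eqxx; lia.
have wE : {subset w <= E} by move=> e /wp/andP[].
have cw e : count_mem e w <= p e.
  rewrite (count_uniq_mem _ (uniq_trail tw)).
  by case: (boolP (e \in w)) => // /wp/andP[].
pose q e := p e - count_mem e w.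
have fq : flow m s z E q.
  move=> x; have := fp x; have := flow_trail uE wE tw x.
  have pE e : p e = q e + count_mem e w by rewrite subnK.
  rewrite /outflow /inflow (eq_bigr _ (fun e _ => pE e)).
  rewrite [X in _ -> _ = X + _ -> _](eq_bigr _ (fun e _ => pE e)).
  by rewrite !big_split /=; do 2 case: ifP; lia.
have [ws [sws wsP wsE]] := IH q fq; exists (w :: ws); split.
- by rewrite /= sws.
- by move=> w'; rewrite inE => /predU1P[->|/wsP].
- by move=> e eE; rewrite big_cons -wsE // addnC subnK.
Qed.

(** * The snake graph of a sequence, its dual and the row of squares *)

Lemma size_blocks a : all (leq 1) a -> size (blocks a) = sumn a.
Proof.
elim: a => //= x a IH /andP[x1 /IH].
rewrite /blocks /= size_cat size_nseq => ->.
by rewrite -addSn prednK.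
Qed.

Lemma blocks_separators a : a != [::] -> blocks a = true :: separators a.
Proof. by case: a. Qed.

(** A comma changes the sign and a plus sign keeps it, so the signs are the
    partial sums modulo 2 of the separators, starting from + before the initial
    comma. *)
Lemma signs_scanl a : all (leq 1) a -> signs a = scanl addb true (blocks a).
Proof.
suff H c i0 : all (leq 1) a ->
    flatten [seq nseq (nth 0 a (i - i0)) (odd (i - i0) (+) c)
               | i <- iota i0 (size a)]
      = scanl addb (~~ c) (blocks a).
  move=> pa; rewrite -(H false 0) //; congr flatten.
  by apply: eq_map => i; rewrite subn0 addbF.
elim: a c i0 => //= x a IH c i0 /andP[x1 pa].
have fx d n s : scanl addb d (nseq n false ++ s) = nseq n d ++ scanl addb d s.
  by elim: n => //= n IHn; rewrite addbF IHn.
rewrite /blocks /= addbT negbK fx -[c in scanl _ c _]negbK.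
rewrite -(IH (~~ c) i0.+1 pa) subnn /=.
rewrite -{1}(prednK x1) /=; congr (_ :: _ ++ flatten _).
apply/eq_in_map => i; rewrite mem_iota => /andP[i0i _].
by rewrite -(subnSK i0i) /= addbN addNb.
Qed.

(** On a tile whose south edge has sign [c], the entry edge has sign [c (+) v],
    because south and west edges have opposite signs.  Opposite edges have
    opposite signs and the exit is opposite to the entry or adjacent to it, so a
    tile is straight iff the sign changes. *)
Lemma build_snake t v c gs : gs != [::] ->
  build t c (take (size gs).-1 (scanl addb (c (+) v) gs)) = snake t v gs.
Proof.
elim: gs t v c => // g [_ t v c _|g' gs IH t v c _] //.
rewrite -[snake _ _ _]/(t :: snake (step (g == v) t) (g == v) (g' :: gs)).
rewrite -(IH _ _ (~~ c)) //= /step.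
by case: g v c => [] [] [].
Qed.

Lemma snake_graph_separators a : a != [::] -> all (leq 1) a ->
  snake_graph a = snake origin false (separators a).
Proof.
move=> a0 pa; rewrite snake_graphE /snake_build signs_scanl //.
rewrite /num_tiles -size_blocks // blocks_separators //=.
case: (separators a) => // g gs.
by rewrite -(@build_snake origin false false (g :: gs)).
Qed.

Lemma of_separators_pos s :
  all (leq 1) (of_separators s) && (of_separators s != [::]).
Proof.
elim: s => //= c s.
case: (of_separators s) => [|x b] /andP[] //= /andP[x1 pb] _.
by case: c; rewrite /= ?x1 pb.
Qed.

Lemma of_separatorsK s : separators (of_separators s) = s.
Proof.
elim: s => //= c s; have /andP[] := of_separators_pos s.
case: (of_separators s) => [|x b] //= /andP[x1 _] _.
rewrite /separators /= => IH.
case: c; rewrite /= ?IH //.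
by rewrite -{1}(prednK x1) /= IH.
Qed.

Lemma separators_dual a : separators (dual a) = map negb (separators a).
Proof. exact: of_separatorsK. Qed.

Lemma row_snake x n :
  [seq (i, 0) | i <- iota x n] = snake (x, 0) true (nseq n true).
Proof. by elim: n x => //= n IH x; rewrite IH. Qed.

Lemma perm_graph_snake t v gs :
  perm_eq (graph_edges (t, v) (snake t v gs)) ((t, v) :: later_edges t v gs).
Proof.
apply: uniq_perm (undup_uniq _) (uniq_later_edges _ _ _) _.
exact: mem_graph_snake.
Qed.

Lemma sink_snake gs :
  sink (snake origin false gs) = tgt (last_edge origin false gs).
Proof.
case: gs => // g gs; rewrite /sink /=.
have lastE t (v h : bool) hs :
    tgt (north (last t (snake (step (h == v) t) (h == v) hs)))
    = tgt (last_edge (step (h == v) t) (h == v) hs).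
  elim: hs t v h => [|h' hs IH] t v h /=.
    by rewrite /tgt /step; case: (h == v).
  exact: IH.
exact: lastE.
Qed.

(** * Counting dimer covers by words *)

Lemma sum_seq_sub (T : choiceType) (r : seq T) (P : pred T) (F : T -> nat) :
  uniq r ->
  \sum_(x : seq_sub r | P (val x)) F (val x) = \sum_(x <- r | P x) F x.
Proof.
move=> ur; rewrite -[in RHS](val_seq_sub_enum ur) big_map; apply: perm_big.
apply: uniq_perm => [||x]; first exact: index_enum_uniq.
  by rewrite -(map_inj_uniq val_inj) val_seq_sub_enum.
by rewrite mem_index_enum mem_seq_sub_enum.
Qed.

Lemma multiplicity_val m (E : seq edge) (p : {ffun seq_sub E -> 'I_m.+1})
    (e : seq_sub E) :
  multiplicity p (val e) = p e.
Proof. by rewrite /multiplicity valK. Qed.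

Lemma size_later_edges t v gs : size (later_edges t v gs) = 3 * size gs.
Proof. by elim: gs t v => //= g gs IH t v; rewrite IH mulnS. Qed.

(** The way back from words to multiplicities; the bound allows values in
    ['I_m.+1]. *)
Lemma labeling_function m (R : seq edge) hs l :
  uniq R -> size R = (3 * size hs).+1 -> l \in labelings m (true :: hs) 0 ->
  exists2 q : edge -> nat, l = [:: 0, 0 & [seq q e | e <- R]]
                         & forall e, e \in R -> q e <= m.
Proof.
move=> uR sR Hl; have := labeling_le (leq0n m) Hl; have := size_labeling Hl.
case/labelings_consP: Hl => k' [l' [_ _ ->]]; pose l1 := m - 0 - k' :: l'.
rewrite -[_ ++ _]/[:: 0, 0 & l1] => sl1 lem.
have {}sl1 : size l1 = size R by move: sl1; rewrite sR /=; lia.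
exists (fun e => nth 0 l1 (index e R)) => [|e eR].
  congr [:: _, _ & _].
  apply: (@eq_from_nth _ 0) => [|i]; rewrite ?size_map // sl1 => iR.
  by rewrite (nth_map (0, 0, false)) // index_uniq.
apply: (allP lem).
by rewrite (mem_cat _ [:: 0; 0] l1) mem_nth ?orbT // sl1 index_mem.
Qed.

(** A multiplicity function is determined by its word of values, so a set of
    functions characterized by words is in bijection with these words. *)
Lemma perm_labelings m (E R : seq edge) hs
    (A : {set {ffun seq_sub E -> 'I_m.+1}}) :
  uniq E -> perm_eq E R -> size R = (3 * size hs).+1 ->
  (forall p, (p \in A) = ([:: 0, 0 & [seq multiplicity p e | e <- R]]
                            \in labelings m (true :: hs) 0)) ->
  perm_eq [seq [:: 0, 0 & [seq multiplicity p e | e <- R]] | p in A]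
          (labelings m (true :: hs) 0).
Proof.
move=> uE ER sR AE; apply: uniq_perm (uniq_labelings _ _ _) _ => [|l].
  rewrite map_inj_in_uniq ?enum_uniq // => p q _ _ [/eq_in_map epq].
  apply/ffunP => e; apply: val_inj; rewrite /= -!multiplicity_val.
  by apply: epq; rewrite -(perm_mem ER); apply: valP.
apply/imageP/idP => [[p pA ->] | Hl]; first by rewrite -AE.
have [|q lE qm] := labeling_function _ sR Hl; first by rewrite -(perm_uniq ER).
pose p : {ffun seq_sub E -> 'I_m.+1} := [ffun e => inord (q (val e))].
have pq : [seq multiplicity p e | e <- R] = [seq q e | e <- R].
  apply/eq_in_map => e eR; have eE : e \in E by rewrite (perm_mem ER).
  by rewrite -[e]/(val (SeqSub eE)) multiplicity_val ffunE inordK // ltnS qm.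
by exists p; rewrite ?AE pq -?lE.
Qed.

Lemma dimer_covers_labelings m t v gs (E : seq edge)
    (R := (t, v) :: later_edges t v gs) p :
  uniq E -> perm_eq E R ->
  (p \in dimer_covers m E) = ([:: 0, 0 & [seq multiplicity p e | e <- R]]
                                \in labelings m (true :: gs) 0).
Proof.
move=> uE ER.
have dE w : \sum_(e : seq_sub E | w \in ends (val e)) p e
    = degree R (multiplicity p) w.
  rewrite /degree -(perm_big _ ER) /= -(sum_seq_sub _ _ uE).
  by apply: eq_bigr => e _; rewrite multiplicity_val.
have vE w : (w \in vertices E) = incident R w.
  rewrite mem_undup /incident -(perm_has _ ER).
  by apply/flatten_mapP/hasP => -[e eE we]; exists e.
rewrite inE; apply/allP/idP => [H | /dimer_snake_edges H w wE].
  apply/dimer_snake_edges => w; case: ifP => [wR|wR].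
    by rewrite -dE; apply/eqP/H; rewrite vE.
  rewrite /degree big_seq_cond big1 // => e /andP[eR we].
  by case/hasP: wR; exists e.
by rewrite dE H -vE wE.
Qed.

Lemma sum_dimer_covers m t v gs E (R := (t, v) :: later_edges t v gs)
    (F : seq nat -> nat) :
  uniq E -> perm_eq E R ->
  \sum_(p in dimer_covers m E) F [:: 0, 0 & [seq multiplicity p e | e <- R]]
    = \sum_(l <- labelings m (true :: gs) 0) F l.
Proof.
move=> uE ER.
have sR : size R = (3 * size gs).+1 by rewrite /= size_later_edges.
have AE p := @dimer_covers_labelings m t v gs E p uE ER.
rewrite -(perm_big _ (perm_labelings uE ER sR AE)) /=.
by rewrite big_map big_enum.
Qed.

Lemma weight_row a q x : a != [::] ->
  weight a [:: 0, 0 & [seq q e | e <- (x, 0, true)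
                         :: later_edges (x, 0) true (nseq (size a).-1 true)]]
  = \prod_(i < size a)
      'C(nth 0 a i + q (x + i, 0, true) - 1, q (x + i, 0, true)).
Proof.
elim: a x => // y [|z a] IH x _; first by rewrite big_ord1 /= addn0 muln1.
rewrite big_ord_recl /= addn0; congr (_ * _).
have := IH x.+1 isT; rewrite /= => ->; apply: eq_bigr => i _.
by rewrite /bump /= addnS addSn.
Qed.

(** * Counting m-lattice paths by words *)

Lemma card_equivalence_partition (T : finType) (U : eqType) (f : T -> U)
    (R : rel T) (D : {set T}) : {in D &, forall x y, R x y = (f x == f y)} ->
  #|equivalence_partition R D| = size (undup [seq f x | x in D]).
Proof.
move=> Rf; pose fiber u := [set y in D | u == f y].
rewrite -(size_map fiber).
have uF : uniq (map fiber (undup [seq f x | x in D])).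
  rewrite map_inj_in_uniq ?undup_uniq // => u v.
  rewrite !mem_undup => /imageP[x xD ->] _ /setP/(_ x).
  by rewrite !inE xD eqxx /= => /esym/eqP.
rewrite -(card_uniqP uF); apply: eq_card => B.
apply/imsetP/mapP => [[x xD ->] | [u]].
  exists (f x); first by rewrite mem_undup image_f.
  by apply/setP=> y; rewrite !inE; case: (boolP (y \in D)) => //= yD; rewrite Rf.
rewrite mem_undup => /imageP[x xD ->] ->; exists x => //.
by apply/setP=> y; rewrite !inE; case: (boolP (y \in D)) => //= yD; rewrite Rf.
Qed.

Lemma is_lattice_path_trail G w : is_snake G ->
  is_lattice_path G w = (w != [::]) && trail origin (sink G) w.
Proof.
move=> /andP[/eqP hG _]; case: w => //= e w.
have -> : head origin G = origin := hG.
congr (_ && _); elim: w e => //= e' w IH e.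
by rewrite -IH eq_sym andbA.
Qed.

Lemma map_val_sub (T : choiceType) (r s : seq T) :
  {subset s <= r} -> exists s' : seq (seq_sub r), [seq val x | x <- s'] = s.
Proof.
elim: s => [|x s IH] sr; first by exists [::].
have [s' <-] : exists s' : seq (seq_sub r), [seq val x | x <- s'] = s.
  by apply: IH => y ys; rewrite sr // inE ys orbT.
have xr : x \in r by rewrite sr ?mem_head.
by exists (SeqSub xr :: s').
Qed.

Section LatticePaths.
Variables (m : nat) (gs : seq bool).
Let G := snake origin false gs.
Let R := (origin, false) :: later_edges origin false gs.
Hypothesis snG : is_snake G.

Let ER : perm_eq (snake_edges G) R := perm_graph_snake origin false gs.

Definition edges_of (w : lattice_path G) : seq edge :=
  [seq val e | e <- val (val w)].

Definition load (P : {ffun lattice_path G -> 'I_m.+1}) (e : edge) : nat :=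
  \sum_w P w * count_mem e (edges_of w).

Lemma load_val P e : load P (val e) = edge_multiplicity P e.
Proof.
apply: eq_bigr => w _; congr (_ * _); rewrite /edges_of count_map.
by apply: eq_count => x; rewrite /= (inj_eq val_inj).
Qed.

Lemma edges_of_trail w :
  trail origin (sink G) (edges_of w) /\ {subset edges_of w <= R}.
Proof.
split; first by have := valP w; rewrite is_lattice_path_trail // => /andP[].
by move=> e /mapP[e' _ ->]; rewrite -(perm_mem ER); apply: valP.
Qed.

Lemma load_flow (P : {ffun lattice_path G -> 'I_m.+1}) :
  \sum_w P w = m -> flow m origin (sink G) R (load P).
Proof.
move=> Pm; rewrite -[X in flow X]Pm; apply: flow_sum => w.
have [tw wR] := edges_of_trail w.
exact: flow_trail (uniq_later_edges _ _ _) wR tw.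
Qed.

Lemma trail_lattice_path w : trail origin (sink G) w -> {subset w <= R} ->
  exists p : lattice_path G, edges_of p = w.
Proof.
move=> tw wR.
have pw : is_lattice_path G w.
  rewrite is_lattice_path_trail // tw andbT; apply: contraTneq tw => -> /=.
  by rewrite sink_snake snake_end_neq.
have [|s sw] := @map_val_sub _ (snake_edges G) w.
  by move=> e /wR; rewrite (perm_mem ER).
have ss : size s == (size G).+1.
  by rewrite -(size_map val) sw (size_lattice_path snG pw).
have ps : is_lattice_path G [seq val e | e <- Tuple ss] by rewrite /= sw.
by exists (exist _ (Tuple ss) ps).
Qed.

Lemma flow_load p : flow m origin (sink G) R p ->
  exists2 P, P \in multipaths m G & {in R, load P =1 p}.
Proof.
move=> fp.
have [ws [sws wsP pE]] := flow_decomposition (uniq_later_edges _ _ _) fp.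
have [lps lpsE] : exists lps : seq (lattice_path G), map edges_of lps = ws.
  elim: ws {sws pE} wsP => [|w ws IH] wsP; first by exists [::].
  have [|lps <-] := IH.
    by move=> w' w'ws; apply: wsP; rewrite inE w'ws orbT.
  have [tw wR] := wsP w (mem_head _ _).
  by have [lp <-] := trail_lattice_path tw wR; exists (lp :: lps).
have sum_count (F : lattice_path G -> nat) :
    \sum_w count_mem w lps * F w = \sum_(w <- lps) F w.
  by apply: sum_count_mem (index_enum_uniq _) _ => w _; rewrite mem_index_enum.
pose P := [ffun w => inord (count_mem w lps) : 'I_m.+1].
have PE w : P w = count_mem w lps :> nat.
  by rewrite ffunE inordK // ltnS -sws -lpsE size_map count_size.
exists P.
  rewrite inE; under eq_bigr do rewrite PE -[count_mem _ _]muln1.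
  by rewrite sum_count sum1_size -(size_map edges_of) lpsE sws.
move=> e eR; rewrite pE // -lpsE big_map -sum_count.
by apply: eq_bigr => w _; rewrite PE.
Qed.

(** Equivalence classes of multipaths correspond to their edge loads, and the
    loads that occur are exactly the flows of value [m]. *)
Lemma card_lattice_paths :
  #|lattice_paths m G| = size (labelings m (true :: map negb gs) 0).
Proof.
pose f (P : {ffun lattice_path G -> 'I_m.+1}) :=
  [:: 0, 0 & [seq load P e | e <- R]].
rewrite /lattice_paths (@card_equivalence_partition _ _ f) => [|P Q _ _].
  apply: perm_size.
  apply: uniq_perm (undup_uniq _) (uniq_labelings _ _ _) _ => l.
  rewrite mem_undup; apply/imageP/idP => [[P] | Hl].
    rewrite inE => /eqP/load_flow fP ->; apply/flow_snake_edges.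
    by rewrite -sink_snake.
  have [|p pl _] :=
    labeling_function (uniq_later_edges origin false gs) _ Hl.
    by rewrite /= size_map size_later_edges.
  move: Hl; rewrite pl => /flow_snake_edges.
  rewrite -sink_snake => /flow_load[P PM PE].
  by exists P => //; congr [:: _, _ & _]; apply/eq_in_map => e /PE.
apply/forallP/eqP => [H | fPQ e].
  congr [:: _, _ & _]; apply/eq_in_map => e.
  rewrite -(perm_mem ER) => eE; rewrite -[e]/(val (SeqSub eE)) !load_val.
  exact/eqP/H.
have /eq_in_map H : [seq load P e | e <- R] = [seq load Q e | e <- R].
  by rewrite -[LHS]/(drop 2 (f P)) fPQ.
by rewrite -!load_val H // -(perm_mem ER); apply: valP.
Qed.

End LatticePaths.

(** * Comparing the three counts *)

Theorem theorem4p9 (m : nat) (a : seq nat) (hm : 1 <= m)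
    (hn : 1 <= size a) (ha : forall i, i < size a -> 1 <= nth 0 a i) :
  bracket m a = #|Omega m a| /\ #|Omega m a| = #|Lstar m a|.
Proof.
have a0 : a != [::] by rewrite -size_eq0 -lt0n.
have pa : all (leq 1) a by apply/(all_nthP 0).
have snake_dual :
    snake_graph (dual a) = snake origin false (map negb (separators a)).
  have /andP[pd d0] := of_separators_pos (map negb (separators a)).
  by rewrite snake_graph_separators // separators_dual.
have OmegaE : #|Omega m a| = size (labelings m (blocks a) 0).
  rewrite -sum1_card /Omega snake_graph_separators // blocks_separators //.
  rewrite -sum1_size.
  exact: (sum_dimer_covers m (fun=> 1) (undup_uniq _) (perm_graph_snake _ _ _)).
split.
  rewrite OmegaE -sum_weight_labelings // /bracket.
  have rowE : perm_eq (row_edges (size a))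
      ((origin, true) :: later_edges origin true (nseq (size a).-1 true)).
    by rewrite /row_edges row_snake; apply: perm_graph_snake.
  have -> : nseq (size a) true = true :: nseq (size a).-1 true by case: (a) a0.
  rewrite -(sum_dimer_covers m _ (undup_uniq _) rowE).
  by apply: eq_bigr => p _; rewrite (weight_row _ 0 a0).
rewrite OmegaE /Lstar snake_dual card_lattice_paths.
  by rewrite (mapK negbK) -blocks_separators.
have [sn _ _] := svalP (snake_graph_sig (dual a)).
by rewrite -snake_dual.
Qed.
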